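(* The algebra $\mathbb{W}$ is isomorphic to the algebra $\mathbb{T}$ over $\mathbb{R}$ with basis $\{1_{\mathbb{T}},\mathbf{e},\mathbf{e}^2,\mathbf{e}^3\}$, where $\mathbf{e}^4=-1_{\mathbb{T}}$, whose multiplication is determined by the table $$\begin{array}{c|cccc}\cdot & 1_{\mathbb{T}} & \mathbf{e} & \mathbf{e}^2 & \mathbf{e}^3\\ \hline 1_{\mathbb{T}} & 1_{\mathbb{T}} & \mathbf{e} & \mathbf{e}^2 & \mathbf{e}^3\\ \mathbf{e} & \mathbf{e} & \mathbf{e}^2 & \mathbf{e}^3 & -1_{\mathbb{T}}\\ \mathbf{e}^2 & \mathbf{e}^2 & \mathbf{e}^3 & -1_{\mathbb{T}} & -\mathbf{e}\\ \mathbf{e}^3 & \mathbf{e}^3 & -1_{\mathbb{T}} & -\mathbf{e} & -\mathbf{e}^2\end{array}$$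
   Context: $\mathbb{W}$ is the real algebra $\mathbb{R}^4$ with standard addition $\oplus$ and scalar multiplication, standard basis $\mathbf{1}=(1,0,0,0)$, $\mathbf{i}=(0,1,0,0)$, $\mathbf{j}=(0,0,1,0)$, $\mathbf{k}=(0,0,0,1)$, and multiplication, for $\mathbf{x}=(X_{\mathbf{1}},X_{\mathbf{i}},X_{\mathbf{j}},X_{\mathbf{k}})$ and $\mathbf{y}=(Y_{\mathbf{1}},Y_{\mathbf{i}},Y_{\mathbf{j}},Y_{\mathbf{k}})$, $$\mathbf{x}\otimes\mathbf{y}=(X_{\mathbf{1}}Y_{\mathbf{1}}-X_{\mathbf{i}}Y_{\mathbf{k}}-X_{\mathbf{j}}Y_{\mathbf{j}}-X_{\mathbf{k}}Y_{\mathbf{i}})\,\mathbf{1}\oplus(X_{\mathbf{1}}Y_{\mathbf{i}}+X_{\mathbf{i}}Y_{\mathbf{1}}-X_{\mathbf{j}}Y_{\mathbf{k}}-X_{\mathbf{k}}Y_{\mathbf{j}})\,\mathbf{i}\oplus(X_{\mathbf{1}}Y_{\mathbf{j}}+X_{\mathbf{i}}Y_{\mathbf{i}}+X_{\mathbf{j}}Y_{\mathbf{1}}-X_{\mathbf{k}}Y_{\mathbf{k}})\,\mathbf{j}\oplus(X_{\mathbf{1}}Y_{\mathbf{k}}+X_{\mathbf{i}}Y_{\mathbf{j}}+X_{\mathbf{j}}Y_{\mathbf{i}}+X_{\mathbf{k}}Y_{\mathbf{1}})\,\mathbf{k}.$$ *)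

(* Defs.v *)
From HB Require Import structures.
From mathcomp Require Import all_boot all_order all_algebra.
From mathcomp Require Import reals.
From mathcomp Require Import ring.

Set Implicit Arguments.
Unset Strict Implicit.
Unset Printing Implicit Defensive.

Import GRing.Theory.
Local Open Scope ring_scope.

Definition i0 : 'I_4 := @Ordinal 4 0 isT.
Definition i1 : 'I_4 := @Ordinal 4 1 isT.
Definition i2 : 'I_4 := @Ordinal 4 2 isT.
Definition i3 : 'I_4 := @Ordinal 4 3 isT.

Lemma ord4P (P : 'I_4 -> Prop) : P i0 -> P i1 -> P i2 -> P i3 -> forall i, P i.
Proof.
move=> P0 P1 P2 P3 [[|[|[|[|//]]]] lti].
- by have -> : Ordinal lti = i0 by apply: val_inj.
- by have -> : Ordinal lti = i1 by apply: val_inj.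
- by have -> : Ordinal lti = i2 by apply: val_inj.
- by have -> : Ordinal lti = i3 by apply: val_inj.
Qed.

Lemma sum_ord4 (V : zmodType) (F : 'I_4 -> V) :
  \sum_i F i = F i0 + F i1 + F i2 + F i3.
Proof.
rewrite !big_ord_recl big_ord0 addr0 !addrA.
by do !congr (_ + _); congr F; apply: val_inj.
Qed.

Section VectorQuadruple.
Variable R : realType.

Definition row4 (a b c d : R) : 'rV[R]_4 := \row_(j < 4) [:: a; b; c; d]`_j.

Lemma row4P (u v : 'rV[R]_4) :
  u 0 i0 = v 0 i0 -> u 0 i1 = v 0 i1 -> u 0 i2 = v 0 i2 -> u 0 i3 = v 0 i3 ->
  u = v.
Proof. by move=> *; apply/rowP; apply: ord4P. Qed.

End VectorQuadruple.

(* An alias of R^4, so that the products on W R and T R below are attached to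
   distinct carriers. *)
Definition W (R : realType) : Type := 'rV[R]_4.

HB.instance Definition _ (R : realType) := Vector.copy (W R) 'rV[R]_4.

Section AlgebraW.
Variable R : realType.
Implicit Types x y z : W R.

Definition W_1 : W R := row4 1 0 0 0.
Definition W_i : W R := row4 0 1 0 0.
Definition W_j : W R := row4 0 0 1 0.
Definition W_k : W R := row4 0 0 0 1.

Definition W_mul x y : W R :=
  let X1 := x 0 i0 in let Xi := x 0 i1 in let Xj := x 0 i2 in let Xk := x 0 i3 in
  let Y1 := y 0 i0 in let Yi := y 0 i1 in let Yj := y 0 i2 in let Yk := y 0 i3 in
    (X1 * Y1 - Xi * Yk - Xj * Yj - Xk * Yi) *: W_1
  + (X1 * Yi + Xi * Y1 - Xj * Yk - Xk * Yj) *: W_i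
  + (X1 * Yj + Xi * Yi + Xj * Y1 - Xk * Yk) *: W_j
  + (X1 * Yk + Xi * Yj + Xj * Yi + Xk * Y1) *: W_k.

Lemma W_mulA : associative W_mul.
Proof. by move=> x y z; apply: row4P; rewrite !mxE /=; ring. Qed.

Lemma W_mulC : commutative W_mul.
Proof. by move=> x y; apply: row4P; rewrite !mxE /=; ring. Qed.

Lemma W_mul1 : left_id W_1 W_mul.
Proof. by move=> x; apply: row4P; rewrite !mxE /=; ring. Qed.

Lemma W_mulDl : left_distributive W_mul +%R.
Proof. by move=> x y z; apply: row4P; rewrite !mxE /=; ring. Qed.

Lemma W_1_neq0 : W_1 != 0.
Proof.
by apply/eqP=> /rowP/(_ i0); rewrite !mxE /= => /eqP; rewrite oner_eq0.
Qed.

Lemma W_scaleAl (a : R) x y : a *: W_mul x y = W_mul (a *: x) y.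
Proof. by apply: row4P; rewrite !mxE /=; ring. Qed.

End AlgebraW.

HB.instance Definition _ (R : realType) :=
  GRing.Zmodule_isComNzRing.Build (W R)
    (@W_mulA R) (@W_mulC R) (@W_mul1 R) (@W_mulDl R) (@W_1_neq0 R).
HB.instance Definition _ (R : realType) :=
  GRing.Lmodule_isLalgebra.Build R (W R) (@W_scaleAl R).
HB.instance Definition _ (R : realType) :=
  GRing.Lalgebra_isComAlgebra.Build R (W R).

(* Formal linear combinations of 1_T, e, e^2, e^3, as coordinate vectors. *)
Definition T (R : realType) : Type := 'rV[R]_4.

HB.instance Definition _ (R : realType) := Vector.copy (T R) 'rV[R]_4.

Section AlgebraT.
Variable R : realType.
Implicit Types x y z : T R.

Definition T_1 : T R := delta_mx 0 i0.
Definition T_e : T R := delta_mx 0 i1.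
Definition T_e2 : T R := delta_mx 0 i2.
Definition T_e3 : T R := delta_mx 0 i3.

Definition T_table : seq (seq (T R)) :=
  [:: [:: T_1;  T_e;   T_e2;  T_e3 ];
      [:: T_e;  T_e2;  T_e3;  - T_1];
      [:: T_e2; T_e3;  - T_1; - T_e];
      [:: T_e3; - T_1; - T_e; - T_e2]].

(* The bilinear extension of the table of products of basis vectors. *)
Definition T_mul x y : T R :=
  \sum_(i < 4) \sum_(j < 4) (x 0 i * y 0 j) *: (nth [::] T_table i)`_j.

Lemma T_mulE x y :
  T_mul x y =
    row4 (x 0 i0 * y 0 i0 - x 0 i1 * y 0 i3 - x 0 i2 * y 0 i2 - x 0 i3 * y 0 i1)
         (x 0 i0 * y 0 i1 + x 0 i1 * y 0 i0 - x 0 i2 * y 0 i3 - x 0 i3 * y 0 i2)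
         (x 0 i0 * y 0 i2 + x 0 i1 * y 0 i1 + x 0 i2 * y 0 i0 - x 0 i3 * y 0 i3)
         (x 0 i0 * y 0 i3 + x 0 i1 * y 0 i2 + x 0 i2 * y 0 i1 + x 0 i3 * y 0 i0).
Proof.
rewrite /T_mul !sum_ord4 /=.
by apply: row4P; rewrite !mxE /=; ring.
Qed.

Lemma T_mulA : associative T_mul.
Proof. by move=> x y z; rewrite !T_mulE; apply: row4P; rewrite !mxE /=; ring. Qed.

Lemma T_mulC : commutative T_mul.
Proof. by move=> x y; rewrite !T_mulE; apply: row4P; rewrite !mxE /=; ring. Qed.

Lemma T_mul1 : left_id T_1 T_mul.
Proof. by move=> x; rewrite T_mulE; apply: row4P; rewrite !mxE /=; ring. Qed.

Lemma T_mulDl : left_distributive T_mul +%R.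
Proof. by move=> x y z; rewrite !T_mulE; apply: row4P; rewrite !mxE /=; ring. Qed.

Lemma T_1_neq0 : T_1 != 0.
Proof.
by apply/eqP=> /rowP/(_ i0); rewrite !mxE /= => /eqP; rewrite oner_eq0.
Qed.

Lemma T_scaleAl (a : R) x y : a *: T_mul x y = T_mul (a *: x) y.
Proof. by rewrite !T_mulE; apply: row4P; rewrite !mxE /=; ring. Qed.

End AlgebraT.

HB.instance Definition _ (R : realType) :=
  GRing.Zmodule_isComNzRing.Build (T R)
    (@T_mulA R) (@T_mulC R) (@T_mul1 R) (@T_mulDl R) (@T_1_neq0 R).
HB.instance Definition _ (R : realType) :=
  GRing.Lmodule_isLalgebra.Build R (T R) (@T_scaleAl R).
HB.instance Definition _ (R : realType) :=
  GRing.Lalgebra_isComAlgebra.Build R (T R).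

Section BasisT.
Variable R : realType.
Notation e := (T_e R).

Lemma T_e2E : T_e2 R = e ^+ 2.
Proof.
by rewrite expr2 [RHS]T_mulE; apply: row4P; rewrite !mxE /=; ring.
Qed.

Lemma T_e3E : T_e3 R = e ^+ 3.
Proof.
by rewrite exprS -T_e2E [RHS]T_mulE; apply: row4P; rewrite !mxE /=; ring.
Qed.

Lemma T_e4E : e ^+ 4 = - 1.
Proof.
by rewrite exprS -T_e3E [LHS]T_mulE; apply: row4P; rewrite !mxE /=; ring.
Qed.

Definition T_basis : 4.-tuple (T R) := [tuple 1; e; e ^+ 2; e ^+ 3].

Lemma T_basisP : basis_of fullv T_basis.
Proof.
have dimT : \dim {: T R} = 4%N by rewrite dimvf.
rewrite basisEdim dimT size_tuple leqnn andbT.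
apply/subvP=> x _.
have -> : x = x 0 i0 *: 1 + x 0 i1 *: e + x 0 i2 *: e ^+ 2 + x 0 i3 *: e ^+ 3.
  by rewrite -T_e2E -T_e3E; apply: row4P; rewrite !mxE /=; ring.
by rewrite !rpredD ?rpredZ ?memv_span // /T_basis ?inE ?eqxx ?orbT.
Qed.

Lemma T_tableP (i j : 'I_4) :
  T_basis`_i * T_basis`_j = (nth [::] (T_table R) i)`_j.
Proof.
move: i j; apply: ord4P; apply: ord4P; rewrite /= -?T_e2E -?T_e3E;
  by rewrite [LHS]T_mulE; apply: row4P; rewrite !mxE /=; ring.
Qed.

End BasisT.

(* Main.v *)
Require Import Defs.
From HB Require Import structures.
From mathcomp Require Import all_boot all_order all_algebra.
From mathcomp Require Import reals.
From mathcomp Require Import ring.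
Local Open Scope ring_scope.

(** With i read as [e], the product of [W R] is multiplication of polynomials in [e] modulo e^4 =
    -1: each wrap past e^3 costs a sign. Expanding the table bilinearly ([T_mulE]) gives the same
    four coordinates. *)

(* [W R] and [T R] share the carrier R^4, and under i |-> e, j |-> e^2,
   k |-> e^3 the two products agree, so the isomorphism is the identity. *)
Definition T_of_W (R : realType) (x : W R) : T R := x.

(** Both module structures are copied from ['rV[R]_4], so conversion suffices. *)
Lemma T_of_W_linear (R : realType) : linear (@T_of_W R).
Proof. by []. Qed.

Lemma T_of_W_monoid_morphism (R : realType) : GRing.monoid_morphism (@T_of_W R).
Proof.
split=> [|x y]; first by apply: row4P; rewrite !mxE.
(* Only the table product needs [T_mulE]; [mxE] unfolds the one on [W R]. *)
by rewrite [RHS]T_mulE; apply: row4P; rewrite !mxE /=; ring.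
Qed.

HB.instance Definition _ (R : realType) :=
  GRing.isLinear.Build R (W R) (T R) *:%R (@T_of_W R) (@T_of_W_linear R).
HB.instance Definition _ (R : realType) :=
  GRing.isMonoidMorphism.Build (W R) (T R) (@T_of_W R)
    (@T_of_W_monoid_morphism R).

Theorem theorem2 (R : realType) : exists f : {lrmorphism W R -> T R}, bijective f.
Proof. by exists (@T_of_W R); exists id. Qed.
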